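(* Let $(F_k)_{k\ge1}$ be an i.i.d. sequence of random variables distributed as $F=\cos\Phi$, where $\Phi$ is uniform on $(-\pi/2,\pi/2)$. For $n\ge1$ we have $\mathbb{P}(F_1F_2\cdots F_n>x)\sim c_n(1-x)^{n/2}$ as $x\to1^-$, where $c_1=\frac{2\sqrt2}{\pi}$, $c_2=\frac2\pi$ and, for $n\ge3$, $c_n=\frac{4}{\pi n}c_{n-2}$. Hence, as $x\to1^-$, $$\mathbb{P}(F_1F_2\cdots F_n>x)\sim\begin{cases}\displaystyle\frac{1}{n!!}\left(\frac4\pi\right)^{n/2}(1-x)^{n/2},&\text{if } n\text{ is even},\\[2mm] \displaystyle\frac{1}{\sqrt2\,n!!}\left(\frac4\pi\right)^{(n+1)/2}(1-x)^{n/2},&\text{if } n\text{ is odd}.\end{cases}$$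
   Context: $f\sim g$ as $x\to1^-$ means $\lim_{x\to1^-}f(x)/g(x)=1$. Double factorial: $0!!=1$, $1!!=1$, $n!!=n\cdot(n-2)!!$ for $n\ge2$. *)

(* Defs.v *)
From HB Require Import structures.
From mathcomp Require Import all_boot all_order all_algebra.
From mathcomp Require Import all_classical all_reals all_analysis.

Set Implicit Arguments.
Unset Strict Implicit.
Unset Printing Implicit Defensive.

Import Order.TTheory GRing.Theory Num.Theory.
Import numFieldNormedType.Exports.

Local Open Scope classical_set_scope.
Local Open Scope ring_scope.

Fixpoint dfact (n : nat) : nat :=
  if n is m.+2 then (n * dfact m)%N else 1%N.

Definition asymp_left (R : realType) (a : R) (f g : R -> R) : Prop :=
  f x / g x @[x --> a^'-] --> (1 : R).

(* Mutual independence: the product rule over every finite subfamily, listed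
   without repetition by [s]. *)
Definition independent_RVs d (T : measurableType d) (R : realType)
    (P : probability T R) (I : choiceType) (X : I -> {RV P >-> R}) : Prop :=
  forall (s : seq I) (A : I -> set R), uniq s ->
    (forall i, measurable (A i)) ->
    P (\bigcap_(i in [set` s]) (X i @^-1` A i)) =
    (\prod_(i <- s) P (X i @^-1` A i))%E.

Lemma Npihalf_lt_pihalf (R : realType) : - (pi / 2) < pi / 2 :> R.
Proof. by rewrite gtrN// divr_gt0// pi_gt0. Qed.

(* [uniform_prob] has its density supported on the closed interval; as a
   measure it is also the uniform law on the open interval. *)
Definition uniform_pihalf d (T : measurableType d) (R : realType)
    (P : probability T R) (Phi : {RV P >-> R}) : Prop :=
  forall A : set R, measurable A ->
    distribution P Phi A = uniform_prob (Npihalf_lt_pihalf R) A.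

(* [X] has the same law as [Y], for variables on possibly different spaces;
   [Y] is a bare function so that it can be [cos \o Phi]. *)
Definition same_law d (T : measurableType d) d' (T' : measurableType d')
    (R : realType) (P : probability T R) (Q : probability T' R)
    (X : {RV P >-> R}) (Y : T' -> R) : Prop :=
  forall A : set R, measurable A ->
    distribution P X A = Q (Y @^-1` A).

(* Main.v *)
(* Write X_n = F_1 ... F_n. By Fubini and scaling,
   P(X_{n+1} > x) = 1/pi int_{-pi/2}^{pi/2} P(X_n > x / cos u) du.
   Since 1 - u^2/2 <= cos u <= 1 / (1 + u^2/2), induction on n traps the tail
   between exact multiples of volumes of Euclidean balls:
     v_n sqrt(2 (1 - x))^n <= P(X_n > x) <= v_n sqrt(2 (1/x - 1))^n,
   where v_{n+1} = v_n (2/pi) int_0^1 (1 - t^2)^{n/2} dt, i.e. v_n is the volume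
   of the unit n-ball divided by pi^n. The quotient of the two bounds is
   x^{-n/2}, which tends to 1, and the recurrence for c_n = v_n 2^{n/2} is the
   Wallis-type identity for two consecutive integrals. *)
Require Import Defs.
From HB Require Import structures.
From mathcomp Require Import all_boot all_order all_algebra.
From mathcomp Require Import all_classical all_reals all_analysis.
From mathcomp Require Import measurable_realfun ring lra.

Set Implicit Arguments.
Unset Strict Implicit.
Unset Printing Implicit Defensive.

Import Order.TTheory GRing.Theory Num.Theory.
Import numFieldNormedType.Exports.

Local Open Scope classical_set_scope.
Local Open Scope ring_scope.

(** * Powers of chords: primitives, boundary values and integrals *)

(* The integral of (1 - t^2)^(n/2) over [0, 1]. *)
Fixpoint ball_coef (R : realType) (n : nat) : R :=
  match n with
  | 0 => 1
  | 1 => pi / 4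
  | m.+2 => m.+2%:R / m.+3%:R * ball_coef R m
  end.

Definition chord (R : realType) (rho u : R) : R := Num.sqrt (rho ^+ 2 - u ^+ 2).

(* The recursion is integration by parts: the derivative of u s^(n+2) with
   s = chord rho u is (n+3) s^(n+2) - (n+2) rho^2 s^n. *)
Fixpoint chord_primitive (R : realType) (rho : R) (n : nat) : R -> R :=
  match n with
  | 0 => id
  | 1 => fun u => (u * chord rho u + rho ^+ 2 * asin (u / rho)) / 2
  | m.+2 => fun u =>
      (u * chord rho u ^+ m.+2 + m.+2%:R * rho ^+ 2 * chord_primitive rho m u)
      / m.+3%:R
  end.

Lemma ball_coef_gt0 (R : realType) n : 0 < ball_coef R n.
Proof.
suff : 0 < ball_coef R n /\ 0 < ball_coef R n.+1 by case.
elim: n => [|n [h1 h2]]; first by split => //=; rewrite divr_gt0 ?pi_gt0.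
by split => //; rewrite /= mulr_gt0// divr_gt0.
Qed.

(** Wallis-type identity: raising [n] by one multiplies the product by [(n+2)/(n+3)], so it
    telescopes down to the value [pi / 4] at [n = 0]. *)
Lemma ball_coef_mul (R : realType) n :
  ball_coef R n * ball_coef R n.+1 = pi / (2 * n.+2%:R).
Proof.
elim: n => [|n ih]; first by rewrite /= mul1r; congr (_ / _); ring.
rewrite [ball_coef R n.+2]/= mulrCA (mulrC (ball_coef R n.+1)) ih.
have n0 : 0 <= n%:R :> R := ler0n _ _.
by field; rewrite !gt_eqF//; lra.
Qed.

Lemma chord_continuous (R : realType) (rho : R) : continuous (chord rho).
Proof.
move=> u; apply: continuous_comp; last exact: sqrt_continuous.
apply: cvgB; first exact: cvg_cst.
exact: exprn_continuous.
Qed.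

Lemma chordX_continuous (R : realType) (rho : R) n :
  continuous (fun u => chord rho u ^+ n).
Proof.
move=> u; apply: (@continuous_comp _ _ _ (chord rho) (fun z => z ^+ n)).
  exact: chord_continuous.
exact: exprn_continuous.
Qed.

Lemma is_derive_chord (R : realType) (rho u : R) : `|u| < rho ->
  is_derive u 1 (chord rho) (- u / chord rho u).
Proof.
move=> h.
have h0 : 0 < rho ^+ 2 - u ^+ 2.
  rewrite subr_gt0 -(real_normK (num_real u)) ltr_pXn2r// nnegrE.
  by rewrite (le_trans _ (ltW h)).
have hs := is_derive1_sqrt h0.
have hi : is_derive u 1 (fun u : R => rho ^+ 2 - u ^+ 2) (- (2 * u)).
  apply: is_derive_eq; rewrite /GRing.scale/=. by ring.
have := @is_derive1_comp _ Num.sqrt (fun u : R => rho ^+ 2 - u ^+ 2) _ _ _ hs hi.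
move=> /is_derive_eq; apply; rewrite /chord.
have : Num.sqrt (rho ^+ 2 - u ^+ 2) != 0 by rewrite gt_eqF// sqrtr_gt0.
by move=> ?; field.
Qed.

(** The strict bound on [u] keeps [chord rho u] nonzero; at the endpoints the square root is not
    differentiable. *)
Lemma is_derive_chord_primitive (R : realType) (rho u : R) n : `|u| < rho ->
  is_derive u 1 (chord_primitive rho n) (chord rho u ^+ n).
Proof.
move=> h.
have rho0 : 0 < rho by rewrite (le_lt_trans _ h).
have h0 : 0 < rho ^+ 2 - u ^+ 2.
  rewrite subr_gt0 -(real_normK (num_real u)) ltr_pXn2r// nnegrE.
  by rewrite (le_trans _ (ltW h)).
have s0 : 0 < chord rho u by rewrite sqrtr_gt0.
have s2 : chord rho u ^+ 2 = rho ^+ 2 - u ^+ 2 by rewrite sqr_sqrtr// ltW.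
have ds := is_derive_chord h.
suff : is_derive u 1 (chord_primitive rho n) (chord rho u ^+ n) /\
  is_derive u 1 (chord_primitive rho n.+1) (chord rho u ^+ n.+1) by case.
elim: n => [|n [h1 h2]].
  split; first by rewrite expr0; exact: is_derive_id.
  have ub : -1 < u / rho < 1.
    by rewrite ltr_pdivlMr// ltr_pdivrMr// mulN1r mul1r -ltr_norml.
  (* [rho * sqrt (1 - (u / rho)^2)] is [chord rho u]: the factor [rho^-1] of the chain rule is
     absorbed into the root. *)
  have da : is_derive u 1 (fun v : R => asin (v / rho)) (chord rho u)^-1.
    have di : is_derive u 1 (fun v : R => v / rho) rho^-1.
      by apply: is_derive_eq; rewrite /GRing.scale/= mulr0 mulr1 add0r.
    have := @is_derive1_comp _ (@asin R) (fun v : R => v / rho) _ _ _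
      (is_derive1_asin ub) di.
    move=> /is_derive_eq; apply.
    rewrite -invfM; congr (_^-1).
    rewrite -{2}(gtr0_norm rho0) -sqrtr_sqr -sqrtrM; last first.
      rewrite subr_ge0 -(real_normK (num_real (u / rho))) expr_le1 ?normr_ge0//.
      by rewrite normf_div (gtr0_norm rho0) ler_pdivrMr// mul1r ltW.
    by rewrite /chord; congr Num.sqrt; field; rewrite gt_eqF.
  have := @is_deriveD _ _ _ _ _ _ _ _ _ (is_deriveM (is_derive_id u 1) ds)
     (is_deriveZ (rho ^+ 2) da).
  move=> /(is_deriveZ 2^-1).
  move=> /is_derive_eq H.
  have -> : chord_primitive rho 1 = 2^-1 *:
      (id * chord rho + rho ^+ 2 *: (fun v : R => asin (v / rho))).
    by apply/funext => v; rewrite /= mulrC.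
  apply: H; rewrite /GRing.scale/= expr1.
  (* Eliminating [rho ^+ 2] leaves a rational identity in [chord rho u] and [u]. *)
  have -> : rho ^+ 2 = chord rho u ^+ 2 + u ^+ 2 by rewrite s2 subrK.
  by field; rewrite gt_eqF.
split => //.
have -> : chord_primitive rho n.+2 = n.+3%:R^-1 *: (id * (chord rho ^+ n.+2)
    + (n.+2%:R * rho ^+ 2) *: chord_primitive rho n).
  by apply/funext => v; rewrite /= mulrC !fctE.
have := is_deriveZ n.+3%:R^-1 (@is_deriveD _ _ _ _ _ _ _ _ _
  (is_deriveM (is_derive_id u 1) (is_deriveX n.+2 ds))
  (is_deriveZ (n.+2%:R * rho ^+ 2) h1)).
move=> /is_derive_eq; apply.
rewrite /GRing.scale/= !fctE /=.
have -> : rho ^+ 2 = chord rho u ^+ 2 + u ^+ 2 by rewrite s2 subrK.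
rewrite (exprS _ n.+1) (exprS _ n).
have n0 : 0 <= n%:R :> R := ler0n _ _.
by field; rewrite !gt_eqF//; lra.
Qed.

Lemma within_continuousM (R : realType) (f g : R -> R) (A : set R) :
  {within A, continuous f} -> {within A, continuous g} ->
  {within A, continuous (fun x => f x * g x)}.
Proof.
by move=> cf cg u; have := @continuousM R (subspace A) f g u; apply; [exact: cf|exact: cg].
Qed.

(** Covers the endpoints, which the derivative lemma excludes and the fundamental theorem of
    calculus requires. *)
Lemma chord_primitive_continuous (R : realType) (rho : R) n : 0 < rho ->
  {within `[- rho, rho], continuous (chord_primitive rho n)}.
Proof.
move=> rho0.
suff : {within `[- rho, rho], continuous (chord_primitive rho n)} /\
  {within `[- rho, rho], continuous (chord_primitive rho n.+1)} by case.
elim: n => [|n [h1 h2]].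
  split; first by apply: continuous_subspaceT => u; exact: cvg_id.
  have ca : {within `[- rho, rho], continuous (fun v : R => asin (v / rho))}.
    (* [asin (v / rho)] inverts the continuous map [t |-> rho * sin t] on a segment, hence is
       continuous up to both endpoints. *)
    have := @segment_can_continuous R (- (pi / 2)) (pi / 2)
      (fun t => rho * sin t) (fun v : R => asin (v / rho)).
    rewrite sinN sin_pihalf mulrN mulr1.
    rewrite (min_l (_ : - rho <= rho)); last by lra.
    rewrite (max_r (_ : - rho <= rho)); last by lra.
    apply.
    - by rewrite ltW// Npihalf_lt_pihalf.
    - apply: continuous_subspaceT => u.
      by apply: continuousM; [exact: cst_continuous|exact: continuous_sin].
    - by move=> t tpi; rewrite mulrAC mulfV ?gt_eqF// mul1r sinK.
  apply: within_continuousM; last exact/continuous_subspaceT/cst_continuous.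
  apply: within_continuousD.
    apply: continuous_subspaceT => u; apply: continuousM => //.
    exact: chord_continuous.
  apply: within_continuousM => //.
  by apply: continuous_subspaceT => u; exact: cst_continuous.
split => //.
apply: within_continuousM; last exact/continuous_subspaceT/cst_continuous.
apply: within_continuousD; apply: within_continuousM => //;
  apply: continuous_subspaceT => u.
- exact: cvg_id.
- exact: chordX_continuous.
- exact: cst_continuous.
Qed.

(** [chord rho] vanishes at both endpoints, so the boundary term of the integration by parts drops
    out and the recursion of [ball_coef] remains. *)
Lemma chord_primitive_diff (R : realType) (rho : R) n : 0 < rho ->
  chord_primitive rho n rho - chord_primitive rho n (- rho) =
  2 * ball_coef R n * rho ^+ n.+1.
Proof.
move=> rho0.
have c0 : chord rho rho = 0 by rewrite /chord subrr sqrtr0.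
have cN0 : chord rho (- rho) = 0 by rewrite /chord sqrrN subrr sqrtr0.
suff : chord_primitive rho n rho - chord_primitive rho n (- rho) =
    2 * ball_coef R n * rho ^+ n.+1 /\
  chord_primitive rho n.+1 rho - chord_primitive rho n.+1 (- rho) =
    2 * ball_coef R n.+1 * rho ^+ n.+2 by case.
elim: n => [|n [h1 h2]].
  split; first by rewrite /= expr1; ring.
  rewrite /= c0 cN0 (_ : - rho / rho = -1) ?divff ?mulNr ?divff ?gt_eqF//.
  have -> : asin (1 : R) = pi / 2.
    have := @sinK R (pi / 2); rewrite sin_pihalf in_itv/= lexx.
    by rewrite ltW ?Npihalf_lt_pihalf//; exact.
  have -> : asin (- 1 : R) = - (pi / 2).
    have := @sinK R (- (pi / 2)); rewrite sinN sin_pihalf in_itv/= lexx.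
    by rewrite ltW ?Npihalf_lt_pihalf//; exact.
  by field.
split => //=; rewrite c0 cN0 !exprS !mul0r !mulr0 !add0r -mulrBl -mulrBr h1.
have n0 : 0 <= n%:R :> R := ler0n _ _.
by rewrite !exprS; field; rewrite !gt_eqF//; lra.
Qed.

Lemma integral_chord (R : realType) (rho : R) n : 0 < rho ->
  (\int[lebesgue_measure]_(u in `[(- rho)%R, rho]) (chord rho u ^+ n)%R%:E =
   (2 * ball_coef R n * rho ^+ n.+1)%R%:E)%E.
Proof.
move=> rho0.
have ab : - rho < rho by lra.
rewrite (@continuous_FTC2 _ _ (chord_primitive rho n))//.
- by rewrite -EFinB chord_primitive_diff.
- apply: continuous_subspaceT => u.
  exact: chordX_continuous.
- have [_ h1 h2] := (continuous_within_itvP _ ab).1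
    (@chord_primitive_continuous _ _ n rho0).
  split => // u; rewrite in_itv/= -ltr_norml.
  by move=> /(is_derive_chord_primitive n) [].
- move=> u; rewrite in_itv/= -ltr_norml => /(is_derive_chord_primitive n) h.
  by rewrite derive1E derive_val.
Qed.

(** * Elementary bounds on the cosine *)

Lemma ge0_is_derive_le (R : realType) (f df : R -> R) (a b : R) :
  (forall x : R, is_derive x 1 f (df x)) ->
  (forall x, a < x < b -> 0 <= df x) ->
  a <= b -> f a <= f b.
Proof.
move=> hf hdf ab; apply: (@ger0_derive1_ndecr R f a b) => //.
- by move=> x; rewrite in_itv/= derive1E derive_val; exact: hdf.
- apply: continuous_subspaceT => x; apply: differentiable_continuous.
  by apply/derivable1_diffP; apply: (@ex_derive _ _ _ _ _ _ _ (hf x)).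
Qed.

Lemma sin_le (R : realType) (u : R) : 0 <= u -> sin u <= u.
Proof.
move=> u0.
have := @ge0_is_derive_le R (fun v => v - sin v) (fun v => 1 - cos v) 0 u.
rewrite sin0 subrr subr_ge0; apply => //.
Qed.

Lemma cos_ge_parabola (R : realType) (u : R) : 1 - u ^+ 2 / 2 <= cos u.
Proof.
wlog u0 : u / 0 <= u => [h|].
  have [/h //|/ltW u0] := leP 0 u.
  by rewrite -sqrrN -cosN; apply: h; rewrite oppr_ge0.
have := @ge0_is_derive_le R (fun v => cos v + v ^+ 2 / 2) (fun v => v - sin v) 0 u.
rewrite cos0 expr0n/= mul0r addr0 -lerBlDr; apply => //.
  move=> v; apply: is_derive_eq; rewrite /GRing.scale/= mulr1.
  by field.
by move=> v /andP[v0 _]; rewrite subr_ge0 sin_le// ltW.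
Qed.

Lemma mul_cos_le_sin (R : realType) (u : R) : 0 <= u <= pi -> u * cos u <= sin u.
Proof.
move=> /andP[u0 upi].
have := @ge0_is_derive_le R (fun v => sin v - v * cos v) (fun v => v * sin v) 0 u.
rewrite sin0 mul0r subrr subr_ge0; apply => //.
  move=> v; apply: is_derive_eq; rewrite /GRing.scale/=.
  by ring.
move=> v /andP[v0 vu]; rewrite mulr_ge0 ?sin_ge0_pi ?(ltW v0)//=.
by rewrite (le_trans (ltW vu)).
Qed.

(** This form of the bound, unlike a polynomial one, lets the upper bound on the tail reproduce
    itself in the induction without an error term. *)
Lemma cos_mul_parabola_le1 (R : realType) (u : R) : `|u| <= pi / 2 ->
  cos u * (1 + u ^+ 2 / 2) <= 1.
Proof.
wlog u0 : u / 0 <= u => [h|].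
  have [/h //|/ltW u0] := leP 0 u.
  by rewrite -sqrrN -cosN -normrN; apply: h; rewrite oppr_ge0.
rewrite ger0_norm// => upi.
have pi0 := pi_ge0 R.
(* The sign makes the function nondecreasing; both summands of its derivative are nonnegative on
   [[0, pi/2]]. *)
have := @ge0_is_derive_le R (fun v => - (cos v * (1 + v ^+ 2 / 2)))
  (fun v => (sin v - v * cos v) + sin v * (v ^+ 2 / 2)) 0 u.
rewrite cos0 expr0n/= mul0r addr0 mulr1 lerN2; apply => //.
  move=> v; apply: is_derive_eq; rewrite /GRing.scale/=.
  by field.
move=> v /andP[v0 vu].
have vpi : 0 <= v <= pi by apply/andP; split; lra.
rewrite addr_ge0 ?subr_ge0 ?mul_cos_le_sin// mulr_ge0 ?sin_ge0_pi//.
by rewrite divr_ge0// sqr_ge0.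
Qed.

(** * Independence of a partial product from the later factors *)

(** In [C], both sides are finite measures on the plane. They agree on rectangles, which are stable
    under intersection and generate the product sigma-algebra, hence they agree everywhere. *)
Lemma probability_pair_inter d (T : measurableType d) (R : realType)
    (P : probability T R) (X Y : T -> R) (E : set T) :
    measurable_fun setT X -> measurable_fun setT Y -> measurable E ->
    (forall A B, measurable A -> measurable B ->
      P (X @^-1` A `&` Y @^-1` B `&` E) = P (X @^-1` A `&` Y @^-1` B) * P E)%E ->
  forall C : set (R * R), measurable C ->
    (P ((fun w => (X w, Y w)) @^-1` C `&` E)
      = P ((fun w => (X w, Y w)) @^-1` C) * P E)%E.
Proof.
move=> mX mY mE h C mC.
have mXY : measurable_fun setT (fun w => (X w, Y w)) by exact: measurable_fun_pair.
have PE0 : 0 <= fine (P E) by rewrite fine_ge0.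
have PEE : (P E = (fine (P E))%:E)%E by rewrite fineK// fin_num_measure.
pose f w := (X w, Y w).
pose m1 : {measure set (R * R) -> \bar R} := pushforward (mrestr P mE) f.
pose m2 : {measure set (R * R) -> \bar R} := mscale (NngNum PE0) (pushforward P f).
suff : m1 mXY C = m2 mXY C.
  by rewrite /m1 /m2 /= /pushforward /mrestr /mscale /= muleC -PEE.
pose G : set (set (R * R)) :=
  [set C | exists A, measurable A /\ exists B, measurable B /\ C = A `*` B].
apply: (@measure_unique _ _ _ G (fun=> setT)) => //.
- rewrite measurable_prod_measurableType //; congr (<<s _ >>).
  rewrite predeqE; split => [[A mA [B mB <-]]|[A [mA [B [mB ->]]]]].
    by exists A; split => //; exists B.
  by exists A => //; exists B.
- move=> _ _ [X1 [mX1 [X2 [mX2 ->]]]] [Y1 [mY1 [Y2 [mY2 ->]]]].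
  rewrite -setXI; exists (X1 `&` Y1); split; first exact: measurableI.
  by exists (X2 `&` Y2); split => //; exact: measurableI.
- by move=> _; exists setT; split => //; exists setT; split => //; rewrite setXTT.
- by rewrite bigcup_const//; exists 0%N.
- move=> _ [A [mA [B [mB ->]]]].
  rewrite /m1 /m2 /= /pushforward /mrestr /mscale /= muleC -PEE.
  exact: h.
- move=> _; rewrite /m1 /= /pushforward /mrestr preimage_setT setTI.
  by rewrite -ge0_fin_numE// fin_num_measure.
Qed.

Lemma measurable_prod_RV d (T : measurableType d) (R : realType)
    (P : probability T R) (F : nat -> {RV P >-> R}) (n : nat) :
  measurable_fun setT (fun w => \prod_(k < n) F k w).
Proof. by apply: measurable_prod => i _; exact: measurable_funP. Qed.

(** Induction on [n]. The event [E] on arbitrary later indices is what the induction feeds on: the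
    step moves index [n] from [E] into the product. *)
Lemma prod_bigcap_indep d (T : measurableType d) (R : realType)
    (P : probability T R) (F : nat -> {RV P >-> R}) (n : nat) :
  independent_RVs F ->
  forall (s : seq nat) (B : nat -> set R) (A : set R),
    uniq s -> all (leq n) s -> (forall i, measurable (B i)) -> measurable A ->
    let X := fun w => \prod_(k < n) F k w in
    let E := \bigcap_(i in [set` s]) (F i @^-1` B i) in
    (P (X @^-1` A `&` E) = P (X @^-1` A) * P E)%E.
Proof.
move=> F_indep.
have mF i B : measurable B -> measurable (F i @^-1` B).
  by move=> mB; rewrite -[X in measurable X]setTI; exact: measurable_funP.
elim: n => [|n ih] s B A us ns mB mA X E.
  (* The empty product is the constant [1], so its event is everything or nothing. *)
  have [A1|A1] := pselect (A 1).
    have -> : X @^-1` A = setT.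
      by apply/seteqP; split => // w _; rewrite /X /= big_ord0.
    by rewrite setTI probability_setT mul1e.
  have -> : X @^-1` A = set0.
    by apply/seteqP; split => // w; rewrite /X /= big_ord0.
  by rewrite set0I measure0 mul0e.
have mE : measurable E by apply: bigcap_measurableType => i _; exact: mF.
have ns' : n \notin s by apply/negP => /(allP ns); rewrite ltnn.
pose Y w := \prod_(k < n) F k w.
have XY : X @^-1` A = (fun w => (Y w, F n w)) @^-1` ((fun p => p.1 * p.2) @^-1` A).
  by apply/seteqP; split => w; rewrite /X /= big_ord_recr.
rewrite XY; apply: probability_pair_inter => //; first exact: measurable_prod_RV.
  move=> A1 A2 mA1 mA2.
  pose B' i := if i == n then A2 else B i.
  have mB' i : measurable (B' i) by rewrite /B'; case: ifP.
  have B'n : B' n = A2 by rewrite /B' eqxx.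
  have EB' : E = \bigcap_(i in [set` s]) (F i @^-1` B' i).
    apply: eq_bigcapr => i /= si; rewrite /B'; case: eqP => // ein.
    by move: ns'; rewrite -ein si.
  have capE : \bigcap_(i in [set` n :: s]) (F i @^-1` B' i) = F n @^-1` A2 `&` E.
    by rewrite EB' !bigcap_seq big_cons B'n.
  have uns : uniq (n :: s) by rewrite /= ns'.
  (* The induction hypothesis splits [Y] from the later indices, with and without [E]; [F_indep]
     then splits [F n] from [E]. *)
  have P1 : P (Y @^-1` A1 `&` F n @^-1` A2 `&` E) = 
     (P (Y @^-1` A1) * P (F n @^-1` A2 `&` E))%E.
    have /= := ih (n :: s) B' A1 uns; rewrite capE setIA.
    apply => //; rewrite leqnn/=; apply: sub_all ns => i; exact: ltnW.
  have P2 : P (Y @^-1` A1 `&` F n @^-1` A2) = (P (Y @^-1` A1) * P (F n @^-1` A2))%E.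
    have /= := ih [:: n] B' A1 isT; rewrite set_cons1 bigcap_set1 B'n; apply => //=.
    by rewrite leqnn.
  have P3 : P (F n @^-1` A2 `&` E) = (P (F n @^-1` A2) * P E)%E.
    have := F_indep (n :: s) B' uns mB'; rewrite capE => ->.
    by rewrite big_cons B'n EB' F_indep.
  by rewrite P1 P2 P3 muleA.
rewrite -[X in measurable X]setTI; apply: measurable_funM => //.
Qed.

(** * Integration against the law of the cosine, and the tail recursion *)

Lemma ge0_integral_law_cos d (T : measurableType d) d' (T' : measurableType d')
    (R : realType) (P : probability T R) (Q : probability T' R)
    (Phi : {RV Q >-> R}) (X : {RV P >-> R}) (f : R -> \bar R) :
  uniform_pihalf Phi -> same_law Q X (fun w => cos (Phi w)) ->
  measurable_fun [set: R] f -> (forall y, 0 <= f y)%E ->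
  (\int[distribution P X]_y f y =
   (pi^-1)%R%:E *
   \int[lebesgue_measure]_(u in `[(- (pi / 2))%R, (pi / 2)%R]) f (cos u))%E.
Proof.
move=> hPhi hX mf f0.
have mcos : measurable_fun setT (@cos R).
  by apply: continuous_measurable_fun; exact: continuous_cos.
have mcosPhi : measurable_fun setT (fun w => cos (Phi w)) by exact: measurableT_comp.
have mfcos : measurable_fun setT (f \o @cos R) by exact: measurableT_comp.
rewrite (eq_measure_integral (pushforward Q (fun w => cos (Phi w)))); last first.
  by move=> A mA _; exact: hX.
rewrite ge0_integral_pushforward// preimage_setT.
transitivity (\int[distribution Q Phi]_u f (cos u))%E.
  by rewrite ge0_integral_distribution.
(* The identity, typed from [measurableTypeR R] to [R], presents the uniform law as a pushforward on
   [R]. *)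
pose idR : measurableTypeR R -> R := idfun.
have midR : measurable_fun setT idR by move=> _ A mA; rewrite setTI.
transitivity (\int[pushforward (uniform_prob (Npihalf_lt_pihalf R)) idR]_u f (cos u))%E.
  by apply: eq_measure_integral => A mA _; exact: hPhi.
rewrite ge0_integral_pushforward// preimage_setT.
rewrite integral_uniform//=.
by congr (_%:E * _)%E; congr (_^-1); field.
Qed.

(** The volume of the unit [n]-ball divided by [pi^n]: slicing a ball by hyperplanes gives the
    factor [2 * ball_coef R m]. *)
Fixpoint tail_coef (R : realType) (n : nat) : R :=
  if n is m.+1 then tail_coef R m * (2 / pi * ball_coef R m) else 1.

Lemma tail_coef_gt0 (R : realType) n : 0 < tail_coef R n.
Proof.
by elim: n => //= n ih; rewrite mulr_gt0// mulr_gt0 ?ball_coef_gt0// divr_gt0 ?pi_gt0.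
Qed.

(** Fubini for the joint law of [F n] and the product before it. Multiplying by [c] instead of
    dividing [x] keeps [f] correct at [c = 0], where a quotient would take the default value [0]. *)
Lemma prod_tail_rec d (T : measurableType d) d' (T' : measurableType d')
    (R : realType) (P : probability T R) (Q : probability T' R)
    (Phi : {RV Q >-> R}) (F : nat -> {RV P >-> R}) (n : nat) (x : R) :
  uniform_pihalf Phi -> independent_RVs F ->
  (forall k, same_law Q (F k) (fun w => cos (Phi w))) ->
  let f c := P [set w | x < (\prod_(k < n) F k w) * c] in
  measurable_fun [set: R] f /\
  (P [set w | (x < \prod_(k < n.+1) F k w)%R] =
   (pi^-1)%R%:E *
   \int[lebesgue_measure]_(u in `[(- (pi / 2))%R, (pi / 2)%R]) f (cos u))%E.
Proof.
move=> hPhi F_indep F_law f.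
have mX := measurable_prod_RV F n.
pose X : {mfun T >-> R} :=
  HB.pack (fun w => \prod_(k < n) F k w) (isMeasurableFun.Build _ _ _ _ _ mX).
pose C : set (R * R) := [set p | x < p.2 * p.1].
have mC : measurable C.
  have -> : C = (fun p => p.2 * p.1) @^-1` `]x, +oo[.
    by apply/seteqP; split => p /=; rewrite in_itv/= andbT.
  by rewrite -[X in measurable X]setTI; exact: measurable_funM.
have fE b : f b = distribution P X (xsection C b).
  rewrite /distribution /pushforward; congr (P _).
  by apply/seteqP; split => w /=; rewrite /xsection/= inE.
have mf : measurable_fun [set: R] f.
  rewrite (_ : f = distribution P X \o xsection C); last exact/funext.
  exact: measurable_fun_xsection.
split => //.
rewrite -(ge0_integral_law_cos hPhi (F_law n))//.
have mFX : measurable_fun setT (fun w => (F n w, X w)) by exact: measurable_fun_pair.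
pose m' : {measure set (R * R) -> \bar R} := pushforward P (fun w => (F n w, X w)).
transitivity (m' mFX C).
  rewrite /m' /= /pushforward; congr (P _).
  by apply/seteqP; split => w /=; rewrite /X /C /= big_ord_recr.
rewrite -(@product_measure_unique _ _ _ _ _ (distribution P (F n)) (distribution P X))//.
  by apply: eq_integral => b _; rewrite fE.
move=> A B mA mB.
(* With the single later index [n], the joint law is the product of its marginals. *)
have := @prod_bigcap_indep _ _ _ P F n F_indep [:: n] (fun=> A) B isT.
rewrite /= leqnn set_cons1 bigcap_set1 => /(_ isT (fun=> mA) mB).
rewrite setIC muleC => <-.
by [].
Qed.

(** * Two-sided bounds on the tail *)

Lemma tail_scale d (T : measurableType d) (R : realType) (P : probability T R)
    (X : T -> R) (x c : R) : 0 < c ->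
  P [set w | x < X w * c] = P [set w | x / c < X w].
Proof.
by move=> c0; congr (P _); apply/seteqP; split => w /=; rewrite ltr_pdivrMr.
Qed.

Lemma tail_scale0 d (T : measurableType d) (R : realType) (P : probability T R)
    (X : T -> R) (x : R) : 0 <= x ->
  P [set w | x < X w * 0] = 0%E.
Proof.
move=> x0; rewrite (_ : mkset _ = set0) ?measure0//.
by apply/seteqP; split => w //=; rewrite mulr0 ltNge x0.
Qed.

Lemma ler_wpM2l_sqrtX (R : realType) (k a b : R) n :
  0 <= k -> a <= b -> k * Num.sqrt a ^+ n <= k * Num.sqrt b ^+ n.
Proof.
move=> k0 ab; rewrite ler_wpM2l// lerXn2r ?nnegrE ?sqrtr_ge0//.
exact: ler_wsqrtr.
Qed.

Lemma integral_chordZ (R : realType) (rho k : R) n : 0 < rho -> 0 <= k ->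
  (\int[lebesgue_measure]_(u in `[(- rho)%R, rho]) (k * chord rho u ^+ n)%R%:E =
   (k * (2 * ball_coef R n * rho ^+ n.+1))%R%:E)%E.
Proof.
move=> rho0 k0; under eq_integral do rewrite EFinM.
rewrite ge0_integralZl_EFin//.
- by rewrite integral_chord// EFinM.
- by move=> u _; rewrite lee_fin exprn_ge0// sqrtr_ge0.
- apply/measurable_EFinP/measurable_funTS.
  by apply: continuous_measurable_fun; exact: chordX_continuous.
Qed.

(** Dividing [x >= 1] by a positive cosine keeps it at least [1]. The upper bound uses this to
    discard the angles with [cos u <= x]. *)
Lemma prod_tail_ge1 d (T : measurableType d) d' (T' : measurableType d')
    (R : realType) (P : probability T R) (Q : probability T' R)
    (Phi : {RV Q >-> R}) (F : nat -> {RV P >-> R}) (n : nat) (x : R) :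
  uniform_pihalf Phi -> independent_RVs F ->
  (forall k, same_law Q (F k) (fun w => cos (Phi w))) ->
  1 <= x -> P [set w | x < \prod_(k < n) F k w] = 0%E.
Proof.
move=> hPhi F_indep F_law; elim: n x => [|n ih] x x1.
  rewrite (_ : mkset _ = set0) ?measure0//.
  by apply/seteqP; split => w //=; rewrite big_ord0 ltNge x1.
have [_ ->] := prod_tail_rec n x hPhi F_indep F_law.
rewrite integral0_eq ?mule0// => u; rewrite /= in_itv/= => /cos_ge0_pihalf.
rewrite le_eqVlt => /predU1P[<-|c0]; first by rewrite tail_scale0// (le_trans ler01).
by rewrite tail_scale// ih// ler_pdivlMr// mul1r (le_trans (cos_le1 u)).
Qed.

(** The integral is cut down to [|u| < rho], where the parabola bound gives [x < cos u], and the
    induction hypothesis is applied at [x / cos u], which again lies in [[1/2, 1)]. *)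
Lemma prod_tail_lower d (T : measurableType d) d' (T' : measurableType d')
    (R : realType) (P : probability T R) (Q : probability T' R)
    (Phi : {RV Q >-> R}) (F : nat -> {RV P >-> R}) (n : nat) (x : R) :
  uniform_pihalf Phi -> independent_RVs F ->
  (forall k, same_law Q (F k) (fun w => cos (Phi w))) ->
  2^-1 <= x < 1 ->
  ((tail_coef R n * Num.sqrt (2 * (1 - x)) ^+ n)%R%:E <= 
    P [set w | (x < \prod_(k < n) F k w)%R])%E.
Proof.
move=> hPhi F_indep F_law; elim: n x => [|n ih] x /andP[x2 x1].
  rewrite (_ : mkset _ = setT) ?probability_setT ?mul1r//.
  by apply/seteqP; split => w //= _; rewrite big_ord0.
have [mf ->] := prod_tail_rec n x hPhi F_indep F_law.
have mfcos : measurable_fun setT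
    (fun u : R => P [set w | (x < (\prod_(k < n) F k w) * cos u)%R]).
  apply: (measurableT_comp mf).
  by apply: continuous_measurable_fun; exact: continuous_cos.
set rho := Num.sqrt (2 * (1 - x)).
have rho0 : 0 < rho by rewrite sqrtr_gt0; lra.
have rho2 : rho ^+ 2 = 2 * (1 - x) by rewrite sqr_sqrtr//; lra.
(* Here [1/2 <= x] enters: it gives [rho <= 1 <= pi / 2], so the cut interval lies inside the domain
   of integration. *)
have rho1 : rho <= pi / 2.
  rewrite (le_trans _ (pihalf_ge1 R))// -(@expr_le1 _ 2)// ?(ltW rho0)// rho2; lra.
have pi0 := pi_gt0 R.
(* Exposes the factor [pi^-1] times the integral of [tail_coef R n * chord rho u ^+ n] over
   [[-rho, rho]]. *)
have -> : tail_coef R n.+1 * rho ^+ n.+1 =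
    pi^-1 * (tail_coef R n * (2 * ball_coef R n * rho ^+ n.+1)).
  by rewrite /=; move: (pi^-1) => q; ring.
rewrite EFinM lee_pmul2l// ?lte_fin ?invr_gt0//.
rewrite -integral_chordZ ?(ltW (tail_coef_gt0 _ _))//.
have v0 := ltW (tail_coef_gt0 R n).
have mchord : measurable_fun setT (fun u => (tail_coef R n * chord rho u ^+ n)%:E).
  apply/measurable_EFinP/measurable_funM => //.
  by apply: continuous_measurable_fun; exact: chordX_continuous.
(* The endpoints are dropped because at [|u| = rho] the parabola bound no longer gives the strict
   [x < cos u]. *)
rewrite -integral_itv_obnd_cbnd; last exact: measurable_funTS.
rewrite -integral_itv_bndo_bndc; last exact: measurable_funTS.
apply: (@le_trans _ _ (\int[lebesgue_measure]_(u in `](- rho)%R, rho[)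
    P [set w | (x < (\prod_(k < n) F k w) * cos u)%R])%E); last first.
  apply: ge0_subset_integral => //.
  - exact: measurable_funTS.
  - by apply: subset_itv; rewrite bnd_simp ?lerN2.
apply: ge0_le_integral => //.
- by move=> u _; rewrite lee_fin mulr_ge0// exprn_ge0// sqrtr_ge0.
- exact: measurable_funTS.
- exact: measurable_funTS.
move=> u; rewrite /= in_itv/= -ltr_norml => urho.
have u2 : u ^+ 2 < 2 * (1 - x).
  by rewrite -rho2 -(real_normK (num_real u)) ltr_pXn2r// nnegrE ltW.
have cu := cos_ge_parabola u.
have xc : x < cos u by lra.
have c0 : 0 < cos u by lra.
rewrite tail_scale//; apply: le_trans (ih _ _); last first.
  rewrite ltr_pdivrMr// mul1r xc andbT ler_pdivlMr//.
  by rewrite (le_trans _ x2)// ler_piMr// ?cos_le1// invr_ge0.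
rewrite lee_fin; apply: ler_wpM2l_sqrtX => //; rewrite rho2.
(* The chain is [2(1 - x) - u^2 <= 2(cos u - x) <= 2(1 - x / cos u)], the last because
   [0 < cos u <= 1]. *)
apply: (@le_trans _ _ (2 * (cos u - x))); first lra.
rewrite ler_wpM2l// -[leLHS]mul1r.
have -> : 1 - x / cos u = (cos u)^-1 * (cos u - x) by field; rewrite gt_eqF.
by rewrite ler_wpM2r ?subr_ge0 ?(ltW xc)// invf_ge1// cos_le1.
Qed.


(** The integrand is dominated pointwise by a multiple of a power of the chord, extended by zero
    outside [[-rho, rho]]. *)
Lemma prod_tail_upper d (T : measurableType d) d' (T' : measurableType d')
    (R : realType) (P : probability T R) (Q : probability T' R)
    (Phi : {RV Q >-> R}) (F : nat -> {RV P >-> R}) (n : nat) (x : R) :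
  uniform_pihalf Phi -> independent_RVs F ->
  (forall k, same_law Q (F k) (fun w => cos (Phi w))) ->
  0 < x < 1 ->
  (P [set w | (x < \prod_(k < n) F k w)%R] <=
   (tail_coef R n * Num.sqrt (2 * (x^-1 - 1)) ^+ n)%R%:E)%E.
Proof.
move=> hPhi F_indep F_law; elim: n x => [|n ih] x /andP[x0 x1].
  rewrite (_ : mkset _ = setT) ?probability_setT ?mul1r//.
  by apply/seteqP; split => w //= _; rewrite big_ord0.
have [mf ->] := prod_tail_rec n x hPhi F_indep F_law.
have mfcos : measurable_fun setT
    (fun u : R => P [set w | (x < (\prod_(k < n) F k w) * cos u)%R]).
  apply: (measurableT_comp mf).
  by apply: continuous_measurable_fun; exact: continuous_cos.
set rho := Num.sqrt (2 * (x^-1 - 1)).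
have y1 : 1 < x^-1 by rewrite invf_gt1.
have rho0 : 0 < rho by rewrite sqrtr_gt0; lra.
have rho2 : rho ^+ 2 = 2 * (x^-1 - 1) by rewrite sqr_sqrtr//; lra.
have pi0 := pi_gt0 R.
have -> : tail_coef R n.+1 * rho ^+ n.+1 =
    pi^-1 * (tail_coef R n * (2 * ball_coef R n * rho ^+ n.+1)).
  by rewrite /=; move: (pi^-1) => q; ring.
rewrite EFinM lee_pmul2l// ?lte_fin ?invr_gt0//.
rewrite -integral_chordZ ?(ltW (tail_coef_gt0 _ _))//.
have v0 := ltW (tail_coef_gt0 R n).
have mchord : measurable_fun setT (fun u => (tail_coef R n * chord rho u ^+ n)%:E).
  apply/measurable_EFinP/measurable_funM => //.
  by apply: continuous_measurable_fun; exact: chordX_continuous.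
have chord0 u : (0 <= (tail_coef R n * chord rho u ^+ n)%:E)%E.
  by rewrite lee_fin mulr_ge0// exprn_ge0// sqrtr_ge0.
(* For small [x] the radius [rho] exceeds [pi / 2]; passing through the whole line avoids comparing
   the two intervals. *)
rewrite [leRHS]integral_mkcond.
apply: (@le_trans _ _
  (\int[lebesgue_measure]_(u in `[(- (pi / 2))%R, (pi / 2)%R])
    ((fun u => (tail_coef R n * chord rho u ^+ n)%:E) \_ `[(- rho)%R, rho]) u)%E);
  last first.
  apply: ge0_subset_integral => //.
  - apply/(measurable_restrictT _ _).1 => //.
    exact: measurable_funTS.
  - by move=> u _; apply: erestrict_ge0.
apply: ge0_le_integral => //.
- exact: measurable_funTS.
- apply: measurable_funTS; apply/(measurable_restrictT _ _).1 => //.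
  exact: measurable_funTS.
move=> u; rewrite /= in_itv/= => upi.
have := cos_ge0_pihalf upi; rewrite le_eqVlt => /predU1P[<-|c0].
  by rewrite tail_scale0 ?(ltW x0)//; exact: erestrict_ge0.
rewrite tail_scale//.
have [cx|xc] := leP (cos u) x.
  rewrite (prod_tail_ge1 _ hPhi)//; first by apply: erestrict_ge0.
  by rewrite ler_pdivlMr// mul1r.
(* From [cos u * (1 + u^2 / 2) <= 1] and [x < cos u] follows [2 cos u <= 2 - x u^2]; then divide by
   [x]. *)
have key : 2 * ((x / cos u)^-1 - 1) <= rho ^+ 2 - u ^+ 2.
  have := @cos_mul_parabola_le1 _ u; rewrite ler_norml => /(_ upi) h.
  have h' : x * u ^+ 2 <= cos u * u ^+ 2 by rewrite ler_wpM2r ?sqr_ge0// ltW.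
  rewrite rho2 invf_div.
  have -> : 2 * (x^-1 - 1) - u ^+ 2 = (2 * (1 - x) - x * u ^+ 2) / x.
    by field; rewrite gt_eqF.
  have -> : 2 * (cos u / x - 1) = (2 * (cos u - x)) / x.
    by field; rewrite gt_eqF.
  by rewrite ler_pM2r ?invr_gt0//; lra.
have xc1 : x / cos u < 1 by rewrite ltr_pdivrMr// mul1r.
have y0 : 0 < x / cos u by rewrite divr_gt0.
(* The left side of [key] is nonnegative because [x / cos u < 1], so [u] lies where the extended
   chord is not cut to zero. *)
have urho : `|u| <= rho.
  rewrite -(@ler_pXn2r _ 2)// ?nnegrE ?(ltW rho0)// real_normK ?num_real//.
  rewrite -subr_ge0; apply: le_trans key; rewrite mulr_ge0// subr_ge0.
  by rewrite invf_ge1// ltW.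
rewrite patchE mem_set; last by rewrite /= in_itv/= -ler_norml.
by rewrite (le_trans (ih _ _)) ?y0// lee_fin ler_wpM2l_sqrtX.
Qed.

(** * The constants: recurrence and closed form *)

Lemma tail_coefSS (R : realType) n :
  tail_coef R n.+2 = 2 / (pi * n.+2%:R) * tail_coef R n.
Proof.
have -> : tail_coef R n.+2 =
    tail_coef R n * (4 / pi ^+ 2 * (ball_coef R n * ball_coef R n.+1)).
  rewrite [LHS]/= -/(ball_coef R n.+1) -exprVn.
  by move: (pi^-1) (ball_coef R n.+1) => q b; ring.
rewrite ball_coef_mul.
have pi0 : pi != 0 :> R by rewrite gt_eqF// pi_gt0.
have n0 : 0 <= n%:R :> R := ler0n _ _.
move: (pi : R) pi0 => p p0; field.
by rewrite p0 gt_eqF//; lra.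
Qed.

(** Two steps contribute [Num.sqrt 2 ^+ 2 = 2], which turns the factor [2 / (pi n)] of [tail_coefSS]
    into the [4 / (pi n)] of the recurrence. *)
Lemma tail_coef_sqrt2 (R : realType) (c : nat -> R) :
  c 1%N = 2 * Num.sqrt 2 / pi -> c 2%N = 2 / pi ->
  (forall n, (3 <= n)%N -> c n = 4 / (pi * n%:R) * c (n - 2)%N) ->
  forall n, (1 <= n)%N -> c n = tail_coef R n * Num.sqrt 2 ^+ n.
Proof.
move=> c1 c2 crec.
have s2 : Num.sqrt 2 ^+ 2 = 2 :> R by rewrite sqr_sqrtr.
have pi0 : pi != 0 :> R by rewrite gt_eqF// pi_gt0.
suff h n : c n.+1 = tail_coef R n.+1 * Num.sqrt 2 ^+ n.+1 /\
    c n.+2 = tail_coef R n.+2 * Num.sqrt 2 ^+ n.+2.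
  by case=> // n _; have [] := h n.
elim: n => [|n [h1 h2]].
  split.
    by rewrite c1 /= expr1; move: (pi^-1) => q; ring.
  rewrite c2 tail_coefSS s2 /= mulr1.
  by move: (pi : R) pi0 => p p0; field.
split => //.
rewrite crec// (_ : (n.+3 - 2)%N = n.+1)// h1 tail_coefSS.
have -> : Num.sqrt 2 ^+ n.+3 = 2 * Num.sqrt 2 ^+ n.+1 :> R.
  by rewrite -(addn2 n.+1) exprD s2 mulrC.
by move: (_^-1) (_ ^+ _) => q s; ring.
Qed.

(** Two steps raise the exponent by one and extend the double factorial by one factor, for either
    parity. *)
Lemma tail_coef_dfact (R : realType) (c : nat -> R) :
  c 1%N = 2 * Num.sqrt 2 / pi -> c 2%N = 2 / pi ->
  (forall n, (3 <= n)%N -> c n = 4 / (pi * n%:R) * c (n - 2)%N) ->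
  forall n, (1 <= n)%N -> c n =
    if odd n then (Num.sqrt 2 * (dfact n)%:R)^-1 * (4 / pi) `^ (n.+1%:R / 2)
    else ((dfact n)%:R)^-1 * (4 / pi) `^ (n%:R / 2).
Proof.
move=> c1 c2 crec.
have pi0 := pi_gt0 R.
have q0 : 0 <= 4 / pi :> R by rewrite divr_ge0// ltW.
have powS n : (4 / pi : R) `^ (n.+2%:R / 2) = 4 / pi * (4 / pi) `^ (n%:R / 2).
  rewrite (_ : n.+2%:R / 2 = 1 + n%:R / 2); last by field.
  rewrite powRD ?powRr1// (gt_eqF (_ : 0 < 4 / pi)) ?divr_gt0//.
  by rewrite implybT.
have dfactS n : (dfact n.+2)%:R^-1 = n.+2%:R^-1 * (dfact n)%:R^-1 :> R.
  by rewrite /= natrM invfM.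
pose a n := if odd n then (Num.sqrt 2 * (dfact n)%:R)^-1 * (4 / pi) `^ (n.+1%:R / 2)
  else ((dfact n)%:R)^-1 * (4 / pi) `^ (n%:R / 2) : R.
suff h n : c n.+1 = a n.+1 /\ c n.+2 = a n.+2.
  by case=> // n _; have [] := h n.
rewrite /a; elim: n => [|n [h1 h2]].
  split.
    rewrite c1 /= mulr1 divff// powRr1// -mulrA mulrCA [_ * (2 / pi)]mulrC.
    have s0 : Num.sqrt 2 != 0 :> R by rewrite gt_eqF// sqrtr_gt0.
    (* One of the two factors [Num.sqrt 2] cancels the inverse root in the odd formula. *)
    rewrite (_ : 4 / pi = Num.sqrt 2 ^+ 2 * (2 / pi)); last first.
      by rewrite sqr_sqrtr//; move: (pi^-1) => q; ring.
    by rewrite mulrA [_^-1 * _ ^+ 2]mulrC expr2 mulfK// mulrC.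
  by rewrite c2 /= muln1 divff// powRr1//; move: (pi^-1) => q; field.
split => //.
have oddS : odd n.+3 = odd n.+1 by rewrite /= negbK.
rewrite crec// (_ : (n.+3 - 2)%N = n.+1)// h1 oddS !invfM dfactS !powS.
by move: (pi^-1) => q; case: ifP => _; ring.
Qed.

(** * Squeeze and conclusion *)

(** Divided by the lower bound, [K] lies between [1] and the quotient of the two bounds,
    [Num.sqrt x^-1 ^+ n], which is continuous at [1] with value [1]. *)
Lemma asymp_left_tail (R : realType) (K : R -> R) (v : R) (n : nat) : 0 < v ->
  (forall x, 2^-1 <= x < 1 -> v * Num.sqrt (2 * (1 - x)) ^+ n <= K x) ->
  (forall x, 0 < x < 1 -> K x <= v * Num.sqrt (2 * (x^-1 - 1)) ^+ n) ->
  asymp_left 1 K (fun x => v * Num.sqrt 2 ^+ n * (1 - x) `^ (n%:R / 2)).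
Proof.
move=> v0 lower upper; rewrite /asymp_left.
have powE x : x < 1 -> v * Num.sqrt 2 ^+ n * (1 - x) `^ (n%:R / 2) =
    v * Num.sqrt (2 * (1 - x)) ^+ n.
  move=> x1; rewrite mulrC [_ / 2]mulrC powRrM powR12_sqrt ?subr_ge0 ?ltW//.
  by rewrite powR_mulrn ?sqrtr_ge0// sqrtrM// exprMn; ring.
apply: (@squeeze_cvgr _ _ _ _ (fun=> 1) (fun x => Num.sqrt (x^-1) ^+ n)).
- near=> x.
  have x1 : x < 1 by near: x; exact: nbhs_left_lt.
  have x2 : 2^-1 < x by near: x; apply: nbhs_left_gt; rewrite invf_lt1// ltr1n.
  have x0 : 0 < x by lra.
  have s0 : 0 < v * Num.sqrt (2 * (1 - x)) ^+ n.
    by rewrite mulr_gt0// exprn_gt0// sqrtr_gt0; lra.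
  rewrite powE// ler_pdivlMr// mul1r lower ?(ltW x2)//=.
  rewrite ler_pdivrMr// mulrCA -exprMn -sqrtrM ?invr_ge0 ?(ltW x0)//.
  rewrite (_ : x^-1 * _ = 2 * (x^-1 - 1)) ?upper ?x0//.
  by field; rewrite gt_eqF.
- exact: cvg_cst.
- apply: cvg_at_left_filter.
  have : {for (1 : R), continuous (fun x : R => Num.sqrt x^-1 ^+ n)}.
    apply: (@continuous_comp _ _ _
      (fun x : R => Num.sqrt x^-1) (fun z => z ^+ n)).
      apply: (@continuous_comp _ _ _ (fun x : R => x^-1) Num.sqrt).
        by apply: inv_continuous; rewrite oner_neq0.
      exact: sqrt_continuous.
    exact: exprn_continuous.
  by rewrite /prop_for /continuous_at invr1 sqrtr1 expr1n.
Unshelve. all: by end_near.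
Qed.

(* F k is the (k+1)-st variable of the sequence F_1, F_2, ... *)
Theorem proposition2p6 (R : realType)
  (d : measure_display) (T : measurableType d) (P : probability T R)
  (d' : measure_display) (T' : measurableType d') (Q : probability T' R)
  (Phi : {RV Q >-> R}) (hPhi : uniform_pihalf Phi)
  (F : nat -> {RV P >-> R})
  (F_indep : independent_RVs F)
  (F_law : forall k : nat, same_law Q (F k) (fun w : T' => cos (Phi w)))
  (c : nat -> R)
  (c1 : c 1%N = 2 * Num.sqrt 2 / pi)
  (c2 : c 2%N = 2 / pi)
  (c_rec : forall n : nat, (3 <= n)%N -> c n = 4 / (pi * n%:R) * c (n - 2)%N) :
  (forall n : nat, (1 <= n)%N ->
     asymp_left 1
       (fun x : R => fine (P [set w | x < \prod_(k < n) F k w]))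
       (fun x : R => c n * (1 - x) `^ (n%:R / 2)))
  /\
  (forall n : nat, (1 <= n)%N ->
     asymp_left 1
       (fun x : R => fine (P [set w | x < \prod_(k < n) F k w]))
       (fun x : R =>
          if odd n then
            (Num.sqrt 2 * (dfact n)%:R)^-1 * (4 / pi) `^ (n.+1%:R / 2)
              * (1 - x) `^ (n%:R / 2)
          else
            ((dfact n)%:R)^-1 * (4 / pi) `^ (n%:R / 2)
              * (1 - x) `^ (n%:R / 2))).
Proof.
have asymp n : (1 <= n)%N -> asymp_left 1
    (fun x : R => fine (P [set w | x < \prod_(k < n) F k w]))
    (fun x : R => c n * (1 - x) `^ (n%:R / 2)).
  move=> n1; rewrite (tail_coef_sqrt2 c1 c2 c_rec n1).
  have mX x : measurable [set w | x < \prod_(k < n) F k w].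
    rewrite (_ : mkset _ = (fun w => \prod_(k < n) F k w) @^-1` `]x, +oo[).
      by rewrite -[X in measurable X]setTI; exact: measurable_prod_RV.
    by apply/seteqP; split => w /=; rewrite in_itv/= andbT.
  apply: asymp_left_tail; first exact: tail_coef_gt0.
  - move=> x x1; rewrite -lee_fin fineK ?fin_num_measure//.
    exact: (prod_tail_lower _ hPhi).
  - move=> x x01; rewrite -lee_fin fineK ?fin_num_measure//.
    exact: (prod_tail_upper _ hPhi).
split => // n n1; have := asymp n n1.
by rewrite (tail_coef_dfact c1 c2 c_rec n1); case: ifP.
Qed.
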